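(* For any two connected graphs $H$ and $G$, $$\chi^L_{G}(H)\leq\left\lceil \frac{\Delta(H)}{\delta(G)}\right\rceil+1.$$
   Context: All graphs are finite, simple and undirected. $\Delta(H)$ is the maximum degree of $H$ and $\delta(G)$ the minimum degree of $G$. $H$ is $G$-free if $H$ contains no subgraph isomorphic to $G$. A list assignment $L$ of $H$ assigns to each vertex $v$ a set $L(v)$ of colors; an $L$-$G$-free coloring is a map $c$ with $c(v)\in L(v)$ for all $v$ such that each color class induces a $G$-free subgraph of $H$. $H$ is $k$-$G$-free-choosable if it has an $L$-$G$-free coloring for every list assignment $L$ with $|L(v)|\ge k$ for all $v$; $\chi_G^L(H)$ is the least such $k$. *)

(* Defs.v *)
From mathcomp Require Import all_boot all_order all_algebra.
From mathcomp Require Import finmap.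

Set Implicit Arguments.
Unset Strict Implicit.
Unset Printing Implicit Defensive.

Record sgraph := SGraph {
  vertex :> finType;
  adj : rel vertex;
  adj_sym : symmetric adj;
  adj_irrefl : irreflexive adj
}.

(* The empty graph is not connected. *)
Definition connected (G : sgraph) : Prop :=
  0 < #|G| /\ forall x y : G, connect (@adj G) x y.

Definition degree (G : sgraph) (x : G) : nat := #|[set y | adj x y]|.

Definition max_degree (G : sgraph) : nat := \max_(x : G) degree x.

(* The neutral value #|G| exceeds every degree, so for nonempty G this is the
   minimum of the degrees. *)
Definition min_degree (G : sgraph) : nat := \big[minn/#|G|]_(x : G) degree x.

Definition isomorphic (G K : sgraph) : Prop :=
  exists2 f : G -> K, bijective f & forall x y, adj (f x) (f y) = adj x y.

Record subgraph (H : sgraph) := Subgraph {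
  sub_vertices : {set H};
  sub_adj : rel H;
  sub_adj_sym : symmetric sub_adj;
  sub_adjP : forall x y, sub_adj x y ->
    [&& x \in sub_vertices, y \in sub_vertices & adj x y]
}.

Section GraphOfSubgraph.
Variables (H : sgraph) (K : subgraph H).

Let V : finType := {x : H | x \in sub_vertices K}.
Let e : rel V := fun x y => sub_adj K (val x) (val y).

Lemma graph_of_sym : symmetric e.
Proof. by move=> x y; apply: sub_adj_sym. Qed.

Lemma graph_of_irrefl : irreflexive e.
Proof.
by move=> x; apply/negP => /sub_adjP /and3P[_ _]; rewrite adj_irrefl.
Qed.

Definition graph_of : sgraph := SGraph graph_of_sym graph_of_irrefl.

End GraphOfSubgraph.

Coercion graph_of : subgraph >-> sgraph.

Section Induced.
Variables (H : sgraph) (S : {set H}).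

Let e : rel H := fun x y => [&& x \in S, y \in S & adj x y].

Lemma induced_sym : symmetric e.
Proof. by move=> x y; rewrite /e adj_sym andbCA. Qed.

Lemma inducedP x y : e x y -> [&& x \in S, y \in S & adj x y].
Proof. by []. Qed.

Definition induced : subgraph H := Subgraph induced_sym inducedP.

End Induced.

Definition graph_free (G H : sgraph) : Prop :=
  ~ exists K : subgraph H, isomorphic G K.

Definition list_free_coloring (G H : sgraph) (C : choiceType)
    (L : H -> {fset C}) (c : H -> C) : Prop :=
  (forall v, c v \in L v) /\
  (forall a : C, graph_free G (induced [set v | c v == a])).

Definition free_choosable (G H : sgraph) (k : nat) : Prop :=
  forall (C : choiceType) (L : H -> {fset C}),
    (forall v, k <= #|` L v|) -> exists c, list_free_coloring G L c.

(* k is the G-free list chromatic number of H; stated as a relation because no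
   such k exists when G has a single vertex and H is nonempty. *)
Definition is_list_chromatic_number (G H : sgraph) (k : nat) : Prop :=
  free_choosable G H k /\ forall j, free_choosable G H j -> k <= j.

(* Main.v *)
(** Put k = floor(Delta(H) / delta(G)) + 1. A vertex v has fewer than
    k * delta(G) neighbours, so some color of L(v) is used on
    fewer than delta(G) of them. Recoloring a vertex that has at least delta(G)
    neighbours of its own color with such a color strictly decreases the number
    of monochromatic edges. When no recoloring is possible, every color class
    induces a graph of maximum degree less than delta(G), which cannot contain
    G. *)

Require Import Defs.
From mathcomp Require Import all_boot all_order all_algebra.
From mathcomp Require Import finmap zify.
From Stdlib Require Import Classical_Prop.

Set Implicit Arguments.
Unset Strict Implicit.
Unset Printing Implicit Defensive.

Lemma min_degree_le (G : sgraph) (x : G) : min_degree G <= degree x.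
Proof.
rewrite /min_degree; have := mem_index_enum x.
elim: (index_enum G) => // y s IHs; rewrite inE big_cons geq_min.
by case/predU1P=> [-> | /IHs ->]; rewrite ?leqnn ?orbT.
Qed.

(** Choosability is a bare proposition quantifying over all list assignments, so the least witness
    comes from excluded middle instead of a search. *)
Lemma ex_least_nat (P : nat -> Prop) (n : nat) :
  P n -> exists2 k, P k /\ (forall j, P j -> k <= j) & k <= n.
Proof.
elim/ltn_ind: n => n IHn Pn.
have [[m [lt_mn Pm]] | no_less] := classic (exists m, m < n /\ P m).
  have [k least_k le_km] := IHn m lt_mn Pm.
  by exists k => //; apply: leq_trans le_km (ltnW lt_mn).
exists n => //; split=> // j Pj.
by rewrite leqNgt; apply/negP => lt_jn; apply: no_less; exists j.
Qed.

Section Recoloring.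

Variables (H : sgraph) (C : choiceType).
Implicit Types (c : H -> C) (v : H) (a : C) (A : {fset C}).

Definition color_degree c v a : nat := \sum_(w | adj v w) (c w == a).

(* Ordered pairs, so every monochromatic edge is counted twice. *)
Definition mono_pairs c : nat := \sum_u color_degree c u (c u).

Definition recolor c v a : H -> C := fun u => if u == v then a else c u.

(** A neighbour of [v] is counted once if its color lies in [A] and not at all otherwise. *)
Lemma sum_color_degree c v A : \sum_(a <- A) color_degree c v a <= degree v.
Proof.
have -> : degree v = \sum_(w | adj v w) 1.
  by rewrite /degree -sum1_card; apply: eq_bigl => w; rewrite inE.
rewrite /color_degree exchange_big /=; apply: leq_sum => w _.
have -> : \sum_(a <- A) (c w == a) = count_mem (c w) A.
  by rewrite -sum1_count [RHS]big_mkcond; apply: eq_bigr => a _; rewrite eq_sym.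
by rewrite count_uniq_mem ?leq_b1 ?fset_uniq.
Qed.

Lemma ex_small_color_degree c v A d :
  degree v < #|` A| * d -> exists2 a, a \in A & color_degree c v a < d.
Proof.
move=> lt_deg; apply/hasP; apply: contraLR lt_deg => /hasPn big_deg.
rewrite -leqNgt; apply: leq_trans (sum_color_degree c v A).
have -> : #|` A| * d = \sum_(a <- A) d.
  by rewrite big_const_seq count_predT iter_addn_0 mulnC.
rewrite big_seq [leqRHS]big_seq; apply: leq_sum => a /big_deg.
by rewrite -leqNgt.
Qed.

(** This isolates the influence of the color of [v]: the second sum never looks at it, and each
    monochromatic edge at [v] is counted from both ends. *)
Lemma mono_pairsE c v :
  mono_pairs c = (color_degree c v (c v)).*2
    + \sum_(u | u != v) \sum_(w | adj u w && (w != v)) (c w == c u).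
Proof.
rewrite /mono_pairs (bigD1 v) //= -addnn -addnA; congr (_ + _).
have -> : color_degree c v (c v) = \sum_(u | u != v) (adj u v && (c v == c u)).
  rewrite /color_degree big_mkcond [RHS]big_mkcond; apply: eq_bigr => u _.
  rewrite adj_sym (eq_sym (c u)); case: (eqVneq u v) => [-> | _] /=.
    by rewrite adj_irrefl.
  by case: (adj u v).
rewrite -big_split /=; apply: eq_bigr => u _; rewrite /color_degree.
(* If [u] is adjacent to [v], the term [w = v] splits off; otherwise excluding [v] changes
   nothing. *)
case uv: (adj u v); first by rewrite (bigD1 v uv).
rewrite add0n; apply: eq_bigl => w; case: (eqVneq w v) => [-> | _].
  by rewrite uv.
by rewrite andbT.
Qed.

Lemma color_degree_recolor c v a b :
  color_degree (recolor c v a) v b = color_degree c v b.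
Proof.
apply: eq_bigr => w vw; rewrite /recolor.
by case: (eqVneq w v) vw => [-> |]; rewrite ?adj_irrefl.
Qed.

Lemma mono_pairs_recolor c v a :
  color_degree c v a < color_degree c v (c v) ->
  mono_pairs (recolor c v a) < mono_pairs c.
Proof.
move=> lt_deg; rewrite !(mono_pairsE _ v) color_degree_recolor.
rewrite {1}/recolor eqxx -addSn; apply: leq_add; first by rewrite ltn_double.
apply: leq_sum => u /negbTE uv; apply: leq_sum => w /andP[_ /negbTE wv].
by rewrite /recolor uv wv.
Qed.

Lemma ex_small_own_color_degree (L : H -> {fset C}) d :
  (forall v, degree v < #|` L v| * d) ->
  exists c, forall v, c v \in L v /\ color_degree c v (c v) < d.
Proof.
move=> lt_deg.
have [c0 c0L] : exists c0, forall v, c0 v \in L v.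
  apply: (fin_all_exists (P := fun v a => a \in L v)) => v.
  (* An empty list would force [degree v < 0]. *)
  apply/fset0Pn; apply: contraTneq (lt_deg v) => ->.
  by rewrite cardfs0.
(* Recoloring terminates by induction on a strict upper bound [n] for [mono_pairs]. *)
have [n] := ubnP (mono_pairs c0).
elim: n c0 c0L => // n IHn c cL; rewrite ltnS => le_n.
have [v /= big_deg | small_deg] := pickP (fun v => d <= color_degree c v (c v)).
  have [a aL small_a] := ex_small_color_degree c (lt_deg v).
  apply: (IHn (recolor c v a)).
    by move=> u; rewrite /recolor; case: (eqVneq u v) => [-> |].
  apply: leq_trans le_n; apply: mono_pairs_recolor.
  exact: leq_trans big_deg.
by exists c => v; split=> //; rewrite ltnNge small_deg.
Qed.

End Recoloring.

Lemma graph_free_color_class (G H : sgraph) (C : choiceType) (c : H -> C) a :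
  0 < #|G| -> (forall v, color_degree c v (c v) < min_degree G) ->
  graph_free G (induced [set v | c v == a]).
Proof.
move=> /card_gt0P[x _] small_deg [K [f /bij_inj f_inj f_adj]].
(* [K] is a subgraph of a subgraph of [H], so two projections lead back to [H]. *)
pose h y : H := val (val (f y)).
have h_inj : injective h by move=> y z /val_inj/val_inj/f_inj.
have h_col y : c (h y) = a by have := valP (val (f y)); rewrite inE => /eqP.
have h_adj y z : adj y z -> adj (h y) (h z).
  by rewrite -f_adj => /sub_adjP/and3P[_ _ /sub_adjP/and3P[]].
have := small_deg (h x); rewrite ltnNge => /negP[].
apply: leq_trans (min_degree_le x) _.
(* The neighbours of [x] embed via [h] into the neighbours of [h x] of color [a], so [h x] has at
   least [degree x] neighbours of its own color. *)
rewrite /degree -(card_imset _ h_inj) /color_degree -sum1_card.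
rewrite big_mkcond [leqRHS]big_mkcond; apply: leq_sum => w _.
case: imsetP => // -[y]; rewrite inE => xy ->.
by rewrite h_adj // !h_col eqxx.
Qed.

Lemma free_choosable_divn (G H : sgraph) :
  0 < #|G| -> 0 < min_degree G ->
  free_choosable G H (max_degree H %/ min_degree G).+1.
Proof.
move=> G_gt0 minG C L cardL.
have [v | c cP] := @ex_small_own_color_degree H C L (min_degree G).
  apply: leq_ltn_trans (leq_bigmax v) _.
  (* The successor of the floor makes this strict: [m < (m %/ d).+1 * d] for positive [d]. *)
  apply: leq_trans (ltn_ceil (max_degree H) minG) _.
  by rewrite leq_mul2r cardL orbT.
exists c; split=> [v | a]; first by case: (cP v).
by apply: graph_free_color_class => // v; case: (cP v).
Qed.

(** The exact rational quotient lies between its floor and its ceiling; this turns the floor bound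
    into the stated one. *)
Lemma divn_le_ceil (m d : nat) :
  0 < d -> ((m %/ d)%:Z <= Num.ceil (m%:Q / d%:Q))%R.
Proof.
move=> d_gt0; rewrite -(ler_int rat).
apply: Order.POrderTheory.le_trans (Num.Theory.ceil_ge _).
rewrite Num.Theory.ler_pdivlMr ?ltr0z // -GRing.rmorphM ler_int.
by rewrite -PoszM lez_nat leq_divM.
Qed.

Theorem theorem3 (H G : sgraph)
    (connH : connected H) (connG : connected G) (minG : 0 < min_degree G) :
  exists2 k : nat, is_list_chromatic_number G H k &
    (k%:Z <= Num.ceil ((max_degree H)%:Q / (min_degree G)%:Q) + 1)%R.
Proof.
have [k k_least le_k] :=
  ex_least_nat (@free_choosable_divn G H (proj1 connG) minG).
exists k => //; have := divn_le_ceil (max_degree H) minG.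
by move: (Num.ceil _) => z; lia.
Qed.
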